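(* Let $K,M\in\mathbb R^{N\times N}$ be the broken curl--curl and mass matrices and let $C\in\mathbb R^{m\times N}$ be a row basis (so of full row rank) of the smoothness matrix imposing tangential continuity and the perfect conductor condition. Let $$\mathcal A=\begin{bmatrix}K&C^T\\C&0\end{bmatrix},\qquad\mathcal M=\begin{bmatrix}M&0\\0&0\end{bmatrix}.$$ Every finite eigenvalue $\lambda$ of $\mathcal Ax=\lambda\mathcal Mx$ having an eigenvector $x=(u,\mu)$ with nonzero primal component $u$ is an eigenvalue of the conforming problem $$u_h\in\ker C\setminus\{0\},\qquad v^TKu_h=\lambda_hv^TMu_h\quad\forall v\in\ker C,$$ and every eigenvalue of the conforming problem is a finite eigenvalue of the pencil. If $M$ is positive definite, then $\ker\mathcal M=\{0\}\times\mathbb R^m$; since $C$ has full row rank the pencil $\mathcal A-\lambda\mathcal M$ is regular, and the multiplier directions $\{0\}\times\mathbb R^m$ contribute only infinite eigenvalues (they belong to the infinite generalized eigenspace of the pencil).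
   Context: Let $\triangle$ be a triangulation of a polygonal domain in $\mathbb R^2$. The broken vector space consists of fields $v$ with $v|_T\in[\mathcal P_d(T)]^2$ on each triangle $T$, $d\ge1$, without continuity across edges, with coefficient vector in $\mathbb R^N$ given by the Bernstein coefficients on each triangle. $K$ and $M$ are the symmetric matrices of the forms $\sum_T\int_T\mathrm{curl}\,u\,\mathrm{curl}\,v$ and $\sum_T\int_Tu\cdot v$ on this space ($\mathrm{curl}\,v=\partial_xv^y-\partial_yv^x$). The smoothness matrix has as rows the functionals giving the jumps of the univariate Bernstein coefficients of the tangential component across each interior edge, and the univariate Bernstein coefficients of the tangential component on each boundary edge; $C$ is a full-row-rank matrix with the same row space. The pencil is regular if $\det(\mathcal A-\lambda\mathcal M)$ is not identically zero in $\lambda$. Its infinite generalized eigenspace is the deflating subspace associated with the eigenvalue $\infty$ in the Weierstrass canonical form of $(\mathcal A,\mathcal M)$. *)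

(* Defs.v *)
From HB Require Import structures.
From mathcomp Require Import all_boot all_order all_algebra.
From mathcomp Require Import all_classical all_reals all_analysis.
From mathcomp Require Import complex ring.

Set Implicit Arguments.
Unset Strict Implicit.
Unset Printing Implicit Defensive.

Import Order.TTheory GRing.Theory Num.Theory numFieldNormedType.Exports.
Local Open Scope classical_set_scope.
Local Open Scope ring_scope.

(** * Triangulations *)

Definition segment (R : realType) (a b : R * R) : set (R * R) :=
  [set p | exists2 s : R, 0 <= s <= 1 &
    p = ((1 - s) * a.1 + s * b.1, (1 - s) * a.2 + s * b.2)].

(* Domains need not be simply connected; the condition on the interior of the
   closure makes Omega open and excludes slits. *)
Definition polygonal_domain (R : realType) (Omega : set (R * R)) : Prop :=
  [/\ Omega !=set0, bounded_set Omega, connected Omega,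
      interior (closure Omega) = Omega &
      exists es : seq ((R * R) * (R * R)),
        closure Omega `\` Omega = \bigcup_(e in [set` es]) segment e.1 e.2].

Definition triangle (R : realType) := 'I_3 -> R * R.

(* Twice the signed area of the triangle abc. *)
Definition orient (R : realType) (a b c : R * R) : R :=
  (b.1 - a.1) * (c.2 - a.2) - (b.2 - a.2) * (c.1 - a.1).

(* Barycentric coordinates; i + 1 and i + 1 + 1 are taken modulo 3. *)
Definition bary (R : realType) (T : triangle R) (i : 'I_3) (p : R * R) : R :=
  orient p (T (i + 1)) (T (i + 1 + 1)) / orient (T 0) (T 1) (T (1 + 1)).

Definition tri_set (R : realType) (T : triangle R) : set (R * R) :=
  [set p | forall i, 0 <= bary T i p].

(* (t, (i, j)) is the side of the triangle t from its vertex i to its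
   vertex j; it is meant for i != j. *)
Definition side (n : nat) : finType := ('I_n * ('I_3 * 'I_3))%type.

Definition src (R : realType) n (T : 'I_n -> triangle R) (e : side n) : R * R :=
  T e.1 e.2.1.

Definition tgt (R : realType) n (T : 'I_n -> triangle R) (e : side n) : R * R :=
  T e.1 e.2.2.

Definition same_side (R : realType) n (T : 'I_n -> triangle R) (e f : side n) :=
  (src T e == src T f) && (tgt T e == tgt T f).

Definition triangulation (R : realType) n (T : 'I_n -> triangle R)
    (Omega : set (R * R)) : Prop :=
  [/\ forall t, orient (T t 0) (T t 1) (T t (1 + 1)) != 0,
      forall s t, s != t ->
        [\/ tri_set (T s) `&` tri_set (T t) = set0,
            exists i j, T s i = T t j /\
              tri_set (T s) `&` tri_set (T t) = [set T s i] |
            exists e f : side n,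
              [/\ e.1 = s, f.1 = t, e.2.1 != e.2.2, same_side T e f &
                  tri_set (T s) `&` tri_set (T t) =
                    segment (src T e) (tgt T e)]] &
      \bigcup_(t in [set: 'I_n]) tri_set (T t) = closure Omega].

(** * The broken space in Bernstein form *)

Definition multi_index (d : nat) : finType :=
  {a : {ffun 'I_3 -> 'I_d.+1} | (\sum_i (a i : nat) == d)%N}.

Definition bernstein (R : realType) d (T : triangle R) (a : multi_index d)
    (p : R * R) : R :=
  (d`!)%:R / (\prod_i (val a i)`!)%:R * \prod_i bary T i p ^+ val a i.

(* (t, y, a) is the coefficient of the Bernstein polynomial a on the triangle
   t, in the first component of the field if y = false, in the second one if
   y = true. *)
Definition dof (n d : nat) : finType := ('I_n * bool * multi_index d)%type.

Definition broken_dim (n d : nat) : nat := #|{: dof n d}|.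

Definition bcoef (R : realType) n d (c : 'cV[R]_(broken_dim n d))
    (t : 'I_n) (a : multi_index d) : R * R :=
  (c (enum_rank ((t, false, a) : dof n d)) 0,
   c (enum_rank ((t, true, a) : dof n d)) 0).

(* Fields without continuity across the edges: one field for each triangle. *)
Definition broken_field (R : realType) n d (T : 'I_n -> triangle R)
    (c : 'cV[R]_(broken_dim n d)) (t : 'I_n) (p : R * R) : R * R :=
  (\sum_(a : multi_index d) (bcoef c t a).1 * bernstein (T t) a p,
   \sum_(a : multi_index d) (bcoef c t a).2 * bernstein (T t) a p).

Definition broken_basis (R : realType) n d (T : 'I_n -> triangle R)
    (i : 'I_(broken_dim n d)) : 'I_n -> R * R -> R * R :=
  broken_field T (delta_mx i 0).

Definition dot (R : realType) (u v : R * R) : R := u.1 * v.1 + u.2 * v.2.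

Definition curl (R : realType) (v : R * R -> R * R) (p : R * R) : R :=
  'D_((1, 0) : R * R) (fun q => (v q).2) p -
  'D_((0, 1) : R * R) (fun q => (v q).1) p.

Definition tri_integral (R : realType) (T : triangle R) (f : R * R -> R) : R :=
  \int[(lebesgue_measure \x lebesgue_measure)%E]_(p in tri_set T) f p.

Definition curlcurl_mx (R : realType) n d (T : 'I_n -> triangle R) :
    'M[R]_(broken_dim n d) :=
  \matrix_(i, j) \sum_t tri_integral (T t)
    (fun p => curl (broken_basis T i t) p * curl (broken_basis T j t) p).

Definition mass_mx (R : realType) n d (T : 'I_n -> triangle R) :
    'M[R]_(broken_dim n d) :=
  \matrix_(i, j) \sum_t tri_integral (T t)
    (fun p => dot (broken_basis T i t p) (broken_basis T j t p)).

(** * The smoothness matrix *)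

Definition tangent (R : realType) (a b : R * R) : R * R :=
  let h := Num.sqrt ((b.1 - a.1) ^+ 2 + (b.2 - a.2) ^+ 2) in
  ((b.1 - a.1) / h, (b.2 - a.2) / h).

(* The l-th univariate Bernstein coefficient, along the side e, of the
   tangential component of the field on the triangle e.1.  The sum has exactly
   one term, the multi-index equal to d - l at the source of e, to l at its
   target and to 0 at the third vertex; see tangential_trace below. *)
Definition tangential_coef (R : realType) n d (T : 'I_n -> triangle R)
    (e : side n) (l : 'I_d.+1) (c : 'cV[R]_(broken_dim n d)) : R :=
  \sum_(a : multi_index d |
        (val a e.2.1 == d - l :> nat)%N && (val a e.2.2 == l))
    dot (tangent (src T e) (tgt T e)) (bcoef c e.1 a).

Lemma ord3_split (P : 'I_3 -> 'I_3 -> 'I_3 -> Prop) :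
  P 0 1 (1 + 1) -> P 0 (1 + 1) 1 -> P 1 0 (1 + 1) ->
  P 1 (1 + 1) 0 -> P (1 + 1) 0 1 -> P (1 + 1) 1 0 ->
  forall i j, i != j -> exists2 k, P i j k & (k != i) && (k != j).
Proof.
move=> h1 h2 h3 h4 h5 h6.
have E (i : 'I_3) : [\/ i = 0, i = 1 | i = 1 + 1].
  by case: i => [[|[|[|i]]] hi] //; [apply: Or31 | apply: Or32 | apply: Or33];
    apply/val_inj.
move=> i j; case: (E i) => ->; case: (E j) => -> // _.
- by exists (1 + 1). - by exists 1. - by exists (1 + 1).
- by exists 0. - by exists 1. - by exists 0.
Qed.

Lemma bary_side (R : realType) (T : triangle R) (i j : 'I_3) (s : R) :
  orient (T 0) (T 1) (T (1 + 1)) != 0 -> i != j ->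
  let p := ((1 - s) * (T i).1 + s * (T j).1,
            (1 - s) * (T i).2 + s * (T j).2) in
  exists2 k, [/\ bary T i p = 1 - s, bary T j p = s & bary T k p = 0] &
             (k != i) && (k != j).
Proof.
move=> nd ij p; rewrite {}/p; move: i j ij; apply: ord3_split;
  rewrite /bary (_ : 1 + 1 + 1 = 0 :> 'I_3); try exact/val_inj;
  rewrite ?add0r ?(_ : 1 + 1 + 1 + 1 = 1 :> 'I_3); try exact/val_inj;
  move: nd; rewrite /orient; move: (T 0) (T 1) (T (1 + 1)) =>
    [a1 a2] [b1 b2] [c1 c2] /= nd; split; field; exact: nd.
Qed.

Lemma big_ord3 (R : Type) (idx : R) (op : Monoid.com_law idx) (F : 'I_3 -> R)
    (i j k : 'I_3) :
  i != j -> (k != i) && (k != j) ->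
  \big[op/idx]_x F x = op (F i) (op (F j) (F k)).
Proof.
move=> ij /andP[ki kj].
rewrite (bigD1 i) //= (bigD1 j) /=; last by rewrite eq_sym.
rewrite (bigD1 k) /=; last by rewrite ki.
rewrite big1 ?Monoid.mulm1 // => x /andP[/andP[xi xj] xk].
have: uniq [:: x; k; j; i].
  by rewrite /= !inE !negb_or xi xj xk ki kj eq_sym ij.
by move/card_uniqP => /= h; have := max_card (mem [:: x; k; j; i]);
   rewrite h card_ord.
Qed.

(* The univariate Bernstein expansion of the tangential trace on a side. *)
Lemma tangential_trace (R : realType) n d (T : 'I_n -> triangle R)
    (e : side n) (c : 'cV[R]_(broken_dim n d)) (s : R) :
  orient (T e.1 0) (T e.1 1) (T e.1 (1 + 1)) != 0 -> e.2.1 != e.2.2 ->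
  dot (tangent (src T e) (tgt T e))
    (broken_field T c e.1 ((1 - s) * (src T e).1 + s * (tgt T e).1,
                           (1 - s) * (src T e).2 + s * (tgt T e).2)) =
  \sum_(l < d.+1) tangential_coef T e l c *
    ('C(d, l)%:R * s ^+ l * (1 - s) ^+ (d - l)).
Proof.
case: e => t [i j]; rewrite /src /tgt /= => nd ij.
have [k [bi bj bk] kij] := bary_side s nd ij.
set p := (_, _) in bi bj bk *; set tau := tangent _ _.
have -> : dot tau (broken_field T c t p) =
    \sum_a dot tau (bcoef c t a) * bernstein (T t) a p.
  rewrite /dot /broken_field /= !mulr_sumr -big_split /=.
  by apply: eq_bigr => a _; rewrite [RHS]mulrDl !mulrA.
under [RHS]eq_bigr => l _ do rewrite /tangential_coef mulr_suml.
rewrite (exchange_big_dep xpredT) //=; apply: eq_bigr => a _.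
rewrite -mulr_sumr; congr (_ * _).
have := valP a; rewrite /= (big_ord3 _ _ ij kij) /= => /eqP ad.
rewrite /bernstein !(big_ord3 _ _ ij kij) /= bi bj bk.
have [ak|ak] := posnP (val a k); last first.
  rewrite big1 ?(expr0n, gtn_eqF ak) ?mulr0 // => l /andP[/eqP ai /eqP aj].
  move: ad ak; rewrite ai aj addnA subnK -1?ltnS //.
  by move=> /eqP; rewrite -[X in _ == X]addn0 eqn_add2l => /eqP ->.
move: ad; rewrite ak addn0 => ad.
have aid : (val a i = d - val a j :> nat)%N by rewrite -[X in (X - _)%N]ad addnK.
rewrite (big_pred1 (val a j)) => [|l]; last first.
  rewrite /= eq_sym; apply/andP/eqP => [[_ /eqP->] //|->].
  by rewrite aid.
rewrite expr0 mulr1 fact0 muln1 aid [(1 - s) ^+ _ * _]mulrC mulrA; congr (_ * _ * _).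
have jd : (val a j <= d)%N by rewrite -ltnS.
rewrite -(bin_fact jd) [X in _ / X%:R]mulnC natrM mulfK //.
Qed.

(* Each interior edge is represented once, by its two sides with a common
   orientation: from i to i + 1 in the triangle of smaller index. *)
Definition is_interior_edge (R : realType) n (T : 'I_n -> triangle R)
    (ef : side n * side n) : bool :=
  [&& ef.1.2.2 == ef.1.2.1 + 1, (ef.1.1 < ef.2.1)%N & same_side T ef.1 ef.2].

Definition is_boundary_edge (R : realType) n (T : 'I_n -> triangle R)
    (e : side n) : bool :=
  (e.2.2 == e.2.1 + 1) &&
  [forall f : side n, (f.1 != e.1) ==> ~~ same_side T e f].

Definition smoothness_row (R : realType) n (T : 'I_n -> triangle R) (d : nat) :
    finType :=
  (({ef | is_interior_edge T ef} + {e | is_boundary_edge T e}) * 'I_d.+1)%type.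

Definition smoothness_functional (R : realType) n d (T : 'I_n -> triangle R)
    (r : smoothness_row T d) (c : 'cV[R]_(broken_dim n d)) : R :=
  match r.1 with
  | inl ef => tangential_coef T (val ef).1 r.2 c -
              tangential_coef T (val ef).2 r.2 c
  | inr e => tangential_coef T (val e) r.2 c
  end.

Definition smoothness_mx (R : realType) n d (T : 'I_n -> triangle R) :
    'M[R]_(#|{: smoothness_row T d}|, broken_dim n d) :=
  \matrix_(r, j) smoothness_functional (enum_val r) (delta_mx j 0).

(** * Matrix pencils and the conforming eigenproblem *)

Definition saddle_mx (F : fieldType) N m (K : 'M[F]_N) (C : 'M[F]_(m, N)) :
    'M[F]_(N + m) :=
  block_mx K C^T C 0.

Definition extended_mass_mx (F : fieldType) N m (M : 'M[F]_N) : 'M[F]_(N + m) :=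
  block_mx M 0 0 0.

Definition regular_pencil (F : fieldType) k (A B : 'M[F]_k) : Prop :=
  exists lambda : F, \det (A - lambda *: B) != 0.

Definition finite_eigenvector (F : fieldType) k (A B : 'M[F]_k) (lambda : F)
    (x : 'cV[F]_k) : Prop :=
  x != 0 /\ A *m x = lambda *: (B *m x).

Definition finite_eigenvalue (F : fieldType) k (A B : 'M[F]_k) (lambda : F) :
    Prop :=
  exists x, finite_eigenvector A B lambda x.

(* Eigenvectors of the reversed pencil B - nu *: A for nu = 0. *)
Definition infinite_eigenvector (F : fieldType) k (A B : 'M[F]_k)
    (x : 'cV[F]_k) : Prop :=
  x != 0 /\ B *m x = 0.

Definition conforming_eigenvalue (F : fieldType) N m (K M : 'M[F]_N)
    (C : 'M[F]_(m, N)) (lambda : F) : Prop :=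
  exists u : 'cV[F]_N,
    [/\ u != 0, C *m u = 0 &
        forall v : 'cV[F]_N, C *m v = 0 ->
          v^T *m K *m u = lambda *: (v^T *m M *m u)].

Definition posdef_mx (R : realType) N (M : 'M[R]_N) : Prop :=
  M^T = M /\ forall u : 'cV[R]_N, u != 0 -> 0 < (u^T *m M *m u) 0 0.

Definition complexify (R : realType) k l (A : 'M[R]_(k, l)) : 'M[R[i]]_(k, l) :=
  map_mx (real_complex R) A.

Definition jordan_block (F : fieldType) k (a : F) : 'M[F]_k :=
  \matrix_(i, j) (a *+ (i == j) + (j == i.+1 :> nat)%:R).

Definition jordan_mx (F : fieldType) k (sz : 'I_k -> nat) (a : 'I_k -> F) :
    'M[F]_(\sum_i sz i) :=
  \mxdiag_i jordan_block (sz i) (a i).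

(* The transformations are typed as rectangular matrices to avoid casts along
   r + s = k, which follows from their invertibility. *)
Record weierstrass_form (F : fieldType) k (A B : 'M[F]_k) := WeierstrassForm {
  nfin : nat;
  fin_size : 'I_nfin -> nat;
  fin_eig : 'I_nfin -> F;
  ninf : nat;
  inf_size : 'I_ninf -> nat;
  wleft : 'M[F]_(\sum_i fin_size i + \sum_i inf_size i, k);
  wright : 'M[F]_(k, \sum_i fin_size i + \sum_i inf_size i);
  wleft_inv : row_free wleft /\ row_full wleft;
  wright_inv : row_free wright /\ row_full wright;
  wA : wleft *m A *m wright =
       block_mx (jordan_mx fin_size fin_eig) 0 0 1%:M;
  wB : wleft *m B *m wright =
       block_mx 1%:M 0 0 (jordan_mx inf_size (fun=> 0))
}.

Definition infinite_deflating_subspace (F : fieldType) k (A B : 'M[F]_k)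
    (W : weierstrass_form A B) : set 'cV[F]_k :=
  [set x | exists y, x = rsubmx (wright W) *m y].

(* The infinite deflating subspace is the same for all Weierstrass forms. *)
Definition infinite_generalized_eigenspace (F : fieldType) k (A B : 'M[F]_k) :
    set 'cV[F]_k :=
  [set x | exists W : weierstrass_form A B, infinite_deflating_subspace W x].

(* Main.v *)
Require Import Defs.
From mathcomp Require Import all_boot all_order all_algebra.
From mathcomp Require Import all_classical all_reals all_analysis.
From mathcomp Require Import complex.

(* If v is in ker C, then v^T C^T mu = 0, so the first block row of the saddle
   point system tested with v is the conforming problem.  Conversely, the residual
   lambda M u - K u of a conforming eigenvector annihilates ker C, so it is C^T mu
   for some mu.

   For M positive definite, put S = C M^-1 C^T, P = M^-1 C^T S^-1, and choose
   a basis Z of ker C with Z^* M Z = 1 and Z^* K Z = Lambda diagonal.  The columns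
   of (Z, -P^* K Z) are finite eigenvectors, those of (0, S^-1) and (P, 0) form m
   Jordan chains of length two at infinity, and the left transformation with rows
   (Z^*, -Z^* K P), (S P^*, -S P^* K P), (0, 1) brings the pencil to Weierstrass
   form.  The multiplier directions are spanned by the heads of these chains. *)

Set Implicit Arguments.
Unset Strict Implicit.
Unset Printing Implicit Defensive.

Import Order.TTheory GRing.Theory Num.Theory numFieldNormedType.Exports.
Local Open Scope classical_set_scope.
Local Open Scope ring_scope.

(** * Finite eigenpairs of the saddle point pencil and the conforming problem *)

Lemma saddle_mx_eigenP (F : fieldType) N m (K M : 'M[F]_N) (C : 'M[F]_(m, N))
    (lambda : F) (u : 'cV[F]_N) (mu : 'cV[F]_m) :
  saddle_mx K C *m col_mx u mu =
    lambda *: (extended_mass_mx m M *m col_mx u mu) <->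
  K *m u + C^T *m mu = lambda *: (M *m u) /\ C *m u = 0.
Proof.
rewrite !mul_block_col !mul0mx !addr0 scale_col_mx scaler0.
by split=> [/eq_col_mx //|[-> ->]].
Qed.

Lemma conforming_eigenvalue_saddle (F : fieldType) N m (K M : 'M[F]_N)
    (C : 'M[F]_(m, N)) (lambda : F) (u : 'cV[F]_N) (mu : 'cV[F]_m) :
  finite_eigenvector (saddle_mx K C) (extended_mass_mx m M) lambda
    (col_mx u mu) ->
  u != 0 -> conforming_eigenvalue K M C lambda.
Proof.
move=> [_ /saddle_mx_eigenP[Ku Cu]] u0; exists u; split=> // v Cv.
have vC : v^T *m C^T = 0 by rewrite -trmx_mul Cv trmx0.
by rewrite -!mulmxA scalemxAr -Ku mulmxDr [X in _ + X]mulmxA vC mul0mx addr0.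
Qed.

Lemma finite_eigenvalue_conforming (F : fieldType) N m (K M : 'M[F]_N)
    (C : 'M[F]_(m, N)) (lambda : F) :
  conforming_eigenvalue K M C lambda ->
  finite_eigenvalue (saddle_mx K C) (extended_mass_mx m M) lambda.
Proof.
move=> [u [u0 Cu Ku]].
pose w := lambda *: (M *m u) - K *m u.
have wC : (w^T <= C)%MS.
  (* Membership in the row space of [C] is tested against [cokermx C], whose columns lie in ker C
     and so are admissible test vectors. *)
  rewrite submxE -(inj_eq trmx_inj) trmx0 trmx_mul trmxK; apply/eqP.
  apply/row_matrixP => i; rewrite row_mul row0 -tr_col /w mulmxBr -scalemxAr.
  by rewrite !mulmxA Ku ?subrr// colE mulmxA mulmx_coker mul0mx.
have /submxP[mu wE] := wC.
exists (col_mx u mu^T); split.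
  by rewrite col_mx_eq0 negb_and u0.
apply/saddle_mx_eigenP; split=> //.
by rewrite -trmx_mul -wE trmxK /w addrC subrK.
Qed.

(** With zero primal part the first block row reads C^T mu = 0, and full row rank of [C] makes C^T
    injective. *)
Lemma finite_eigenvector_primal_neq0 (F : fieldType) N m (K M : 'M[F]_N)
    (C : 'M[F]_(m, N)) (lambda : F) (mu : 'cV[F]_m) :
  row_free C ->
  ~ finite_eigenvector (saddle_mx K C) (extended_mass_mx m M) lambda
      (col_mx 0 mu).
Proof.
move=> Cfree [mu0 /saddle_mx_eigenP[]].
rewrite !mulmx0 add0r scaler0 => /(congr1 trmx).
rewrite trmx_mul trmxK trmx0 => /eqP; rewrite mulmx_free_eq0 //.
rewrite -(inj_eq trmx_inj) trmx0 trmxK => /eqP E _.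
by move: mu0; rewrite E col_mx0 eqxx.
Qed.

(** * Weierstrass forms from eigenvectors and Jordan chains *)

Lemma mulmx_mxcol_mxrow (F : fieldType) k p q (p_ : 'I_p -> nat)
    (q_ : 'I_q -> nat) (A : 'M[F]_k) (P_ : forall i, 'M[F]_(p_ i, k))
    (Q_ : forall j, 'M[F]_(k, q_ j)) :
  \mxcol_i P_ i *m A *m \mxrow_j Q_ j = \mxblock_(i, j) (P_ i *m A *m Q_ j).
Proof. by rewrite mxcol_mul mul_mxcol_mxrow. Qed.

Lemma mulmx_col_row (F : fieldType) k p1 p2 q1 q2 (A : 'M[F]_k)
    (P1 : 'M[F]_(p1, k)) (P2 : 'M[F]_(p2, k))
    (Q1 : 'M[F]_(k, q1)) (Q2 : 'M[F]_(k, q2)) :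
  col_mx P1 P2 *m A *m row_mx Q1 Q2 =
  block_mx (P1 *m A *m Q1) (P1 *m A *m Q2) (P2 *m A *m Q1) (P2 *m A *m Q2).
Proof. by rewrite mul_col_mx mul_col_row. Qed.

Lemma row_mulmx_col (F : fieldType) k p q (A : 'M[F]_k) (P : 'M[F]_(p, k))
    (Q : 'M[F]_(k, q)) i j :
  row i P *m A *m col j Q = ((P *m A *m Q) i j)%:M.
Proof.
by apply/matrixP => a b; rewrite colE mulmxA -!row_mul -colE !mxE !ord1 eqxx mulr1n.
Qed.

Lemma mulmx_sum_col_row (F : fieldType) p q r (A : 'M[F]_(p, q))
    (B : 'M[F]_(q, r)) :
  A *m B = \sum_i col i A *m row i B.
Proof.
apply/matrixP => a b; rewrite summxE mxE; apply: eq_bigr => i _.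
by rewrite mxE big_ord1 !mxE.
Qed.

(** A row vector annihilating [P] annihilates both canonical forms; the identity block of the first
    kills its right half, that of the second its left half. *)
Lemma row_free_pencil (F : fieldType) k r s (A B : 'M[F]_k)
    (P : 'M[F]_(r + s, k)) (Q : 'M[F]_(k, r + s)) (J : 'M[F]_r) (N : 'M[F]_s) :
  P *m A *m Q = block_mx J 0 0 1%:M -> P *m B *m Q = block_mx 1%:M 0 0 N ->
  row_free P.
Proof.
move=> AE BE; apply: inj_row_free => v; rewrite -[v]hsubmxK => vP.
have := congr1 (mulmx (row_mx (lsubmx v) (rsubmx v))) BE.
have := congr1 (mulmx (row_mx (lsubmx v) (rsubmx v))) AE.
rewrite !mulmxA vP !mul0mx !mul_row_block !mulmx0 !addr0 !add0r !mulmx1.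
move=> /esym/eqP; rewrite row_mx_eq0 => /andP[_ /eqP->].
by move=> /esym/eqP; rewrite row_mx_eq0 => /andP[/eqP-> _]; rewrite row_mx0.
Qed.

Lemma row_full_pencil (F : fieldType) k r s (A B : 'M[F]_k)
    (P : 'M[F]_(r + s, k)) (Q : 'M[F]_(k, r + s)) (J : 'M[F]_r) (N : 'M[F]_s) :
  P *m A *m Q = block_mx J 0 0 1%:M -> P *m B *m Q = block_mx 1%:M 0 0 N ->
  row_full Q.
Proof.
move=> /(congr1 trmx) + /(congr1 trmx).
rewrite !tr_block_mx !trmx_mul !trmx0 !trmx1 !mulmxA => AE BE.
by have := row_free_pencil AE BE; rewrite /row_free mxrank_tr.
Qed.

(* The i-th columns of [X] and [Y] form a Jordan chain of length two at infinity,
   so they are interleaved into blocks of two columns in the Weierstrass form. *)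
Lemma weierstrass_form_chains (F : fieldType) k r m (A B : 'M[F]_k)
    (Lf : 'M[F]_(r, k)) (L0 L1 : 'M[F]_(m, k))
    (Xf : 'M[F]_(k, r)) (X Y : 'M[F]_(k, m)) (D : 'rV[F]_r) :
  k = (r + (m + m))%N ->
  col_mx Lf (col_mx L0 L1) *m A *m row_mx Xf (row_mx X Y) =
    block_mx (diag_mx D) 0 0 1%:M ->
  col_mx Lf (col_mx L0 L1) *m B *m row_mx Xf (row_mx X Y) =
    block_mx 1%:M 0 0 (block_mx 0 1%:M 0 0) ->
  exists W : weierstrass_form A B,
    forall v : 'cV[F]_m, infinite_deflating_subspace W (X *m v).
Proof.
move=> kE.
rewrite !mulmx_col_row !mul_mx_row !mul_col_mx scalar_mx_block.
move=> /eq_block_mx[AE00 AE01 AE10 /eq_block_mx[AE11 AE12 AE21 AE22]].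
move: AE01 AE10 => /eqP + /eqP; rewrite row_mx_eq0 col_mx_eq0.
move=> /andP[/eqP AE01 /eqP AE02] /andP[/eqP AE10 /eqP AE20].
move=> /eq_block_mx[BE00 BE01 BE10 /eq_block_mx[BE11 BE12 BE21 BE22]].
move: BE01 BE10 => /eqP + /eqP; rewrite row_mx_eq0 col_mx_eq0.
move=> /andP[/eqP BE01 /eqP BE02] /andP[/eqP BE10 /eqP BE20].
pose fs := fun _ : 'I_r => 1%N.
pose js := fun _ : 'I_m => (1 + 1)%N.
pose wl := col_mx (\mxcol_i (row i Lf : 'M[F]_(fs i, k)))
  (\mxcol_i (col_mx (row i L0) (row i L1) : 'M[F]_(js i, k))).
pose wr := row_mx (\mxrow_i (col i Xf : 'M[F]_(k, fs i)))
  (\mxrow_i (row_mx (col i X) (col i Y) : 'M[F]_(k, js i))).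
have wAE : wl *m A *m wr =
    block_mx (jordan_mx fs (fun i => D 0 i)) 0 0 1%:M.
  rewrite mulmx_col_row !mulmx_mxcol_mxrow; congr block_mx.
  - apply/eq_mxblockP => i j; rewrite row_mulmx_col AE00 mxE.
    case: (eqVneq i j) => [->|]; last by rewrite raddf0.
    by rewrite conform_mx_id; apply/matrixP => a b; rewrite !mxE !ord1 !eqxx /= addr0.
  - rewrite -[RHS]mxblock0; apply/eq_mxblockP => i j.
    by rewrite mul_mx_row !row_mulmx_col AE01 AE02 mxE raddf0 row_mx0.
  - rewrite -[RHS]mxblock0; apply/eq_mxblockP => i j.
    by rewrite !mul_col_mx !row_mulmx_col AE10 AE20 mxE raddf0 col_mx0.
  - rewrite -mxdiagZ; apply/eq_mxblockP => i j.
    rewrite mulmx_col_row !row_mulmx_col AE11 AE12 AE21 AE22 !mxE.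
    case: (eqVneq i j) => [->|].
      by rewrite conform_mx_id !raddf0 -scalar_mx_block.
    by rewrite !raddf0 block_mx0.
have wBE : wl *m B *m wr =
    block_mx 1%:M 0 0 (jordan_mx js (fun=> 0)).
  rewrite mulmx_col_row !mulmx_mxcol_mxrow; congr block_mx.
  - rewrite -mxdiagZ; apply/eq_mxblockP => i j; rewrite row_mulmx_col BE00 mxE.
    case: (eqVneq i j) => [->|]; last by rewrite raddf0.
    by rewrite conform_mx_id.
  - rewrite -[RHS]mxblock0; apply/eq_mxblockP => i j.
    by rewrite mul_mx_row !row_mulmx_col BE01 BE02 mxE raddf0 row_mx0.
  - rewrite -[RHS]mxblock0; apply/eq_mxblockP => i j.
    by rewrite !mul_col_mx !row_mulmx_col BE10 BE20 mxE raddf0 col_mx0.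
  - apply/eq_mxblockP => i j.
    rewrite mulmx_col_row !row_mulmx_col BE11 BE12 BE21 BE22 !mxE.
    case: (eqVneq i j) => [->|]; last by rewrite !raddf0 block_mx0.
    rewrite conform_mx_id !raddf0; apply/matrixP => a b.
    rewrite [RHS]mxE; case: (split_ordP a) => a' ->; case: (split_ordP b) => b' ->;
    by rewrite ?block_mxEul ?block_mxEur ?block_mxEdl ?block_mxEdr !mxE !ord1 /=
      ?mul0rn ?add0r.
(* By this count [wl] and [wr] are square, so each one-sided rank property gives the other. *)
have sE : k = (\sum_i fs i + \sum_i js i)%N.
  by rewrite kE !sum_nat_const !card_ord muln1 mulnDr muln1.
have wlf := row_free_pencil wAE wBE; have wrf := row_full_pencil wAE wBE.
have wlF : row_free wl /\ row_full wl.
  by split=> //; move: wlf; rewrite /row_free /row_full => /eqP->; apply/eqP.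
have wrF : row_free wr /\ row_full wr.
  by split=> //; move: wrf; rewrite /row_free /row_full => /eqP->; apply/eqP.
exists (WeierstrassForm wlF wrF wAE wBE) => v.
(* Coordinates of [X *m v]: the i-th entry of [v] on the head of chain i, zero on its second
   vector. *)
exists (\mxcol_i (col_mx (row i v) 0 : 'M[F]_(js i, 1))) => /=.
rewrite row_mxKr mul_mxrow_mxcol.
under eq_bigr => i _ do rewrite mul_row_col mulmx0 addr0.
by rewrite mulmx_sum_col_row.
Qed.

(* For M Hermitian and C real, P is M^-1 C^T S^-1 with S = C M^-1 C^T, P' is P^*,
   S' is S^-1, and Z is an M-orthonormal basis of ker C diagonalizing K. *)
Lemma saddle_infinite_eigenspace_basis (F : fieldType) N m r (K M : 'M[F]_N)
    (C : 'M[F]_(m, N)) (P : 'M[F]_(N, m)) (P' : 'M[F]_(m, N)) (S S' : 'M[F]_m)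
    (Z : 'M[F]_(N, r)) (Z' : 'M[F]_(r, N)) (D : 'rV[F]_r) (mu : 'cV[F]_m) :
  N = (r + m)%N ->
  C *m Z = 0 -> Z' *m C^T = 0 ->
  Z' *m M *m Z = 1%:M -> Z' *m K *m Z = diag_mx D ->
  C *m P = 1%:M -> P' *m C^T = 1%:M ->
  M *m P = C^T *m S' -> P' *m M = S' *m C -> S *m S' = 1%:M ->
  infinite_generalized_eigenspace (saddle_mx K C) (extended_mass_mx m M)
    (col_mx 0 mu).
Proof.
move=> NE CZ ZC ZMZ ZKZ CP PC MP PM SS.
(* The multiplier part of [Xf] cancels P' K Z, because P' C^T = 1; the second blocks of [Lf] and
   [L0] cancel the products with K P likewise, because C P = 1. *)
pose Xf := col_mx Z (- (P' *m K *m Z)).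
(* Chains at infinity: the extended mass matrix sends [X] to 0 and, since M P = C^T S', sends [Y] to
   the image of [X] under the saddle point matrix. *)
pose X := col_mx (0 : 'M[F]_(N, m)) S'; pose Y := col_mx P (0 : 'M[F]_(m, m)).
pose Lf := row_mx Z' (- (Z' *m K *m P)).
pose L0 := row_mx (S *m P') (- (S *m P' *m K *m P)).
pose L1 := row_mx (0 : 'M[F]_(m, N)) (1%:M : 'M[F]_m).
have [||| W WX] := @weierstrass_form_chains F (N + m) r m
    (saddle_mx K C) (extended_mass_mx m M) Lf L0 L1 Xf X Y D.
- by rewrite NE addnA.
- have LA := (mul_row_block, mul_row_col).
  rewrite !mulmx_col_row !mul_col_mx !mul_mx_row !LA.
  rewrite !(mulmx0, mul0mx, addr0, add0r, mul1mx) !mulNmx !mulmxN.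
  rewrite !mulmxDl !mulNmx -![_ *m C *m _]mulmxA CZ CP !mulmx0 mulmx1.
  rewrite ZKZ ZC !mul0mx !oppr0 !addr0 mulmx1.
  rewrite -![S *m P' *m C^T]mulmxA PC mulmx1 SS !mulmxA !subrr.
  by rewrite [in RHS]scalar_mx_block row_mx0 col_mx0.
- have LA := (mul_row_block, mul_row_col).
  rewrite !mulmx_col_row !mul_col_mx !mul_mx_row !LA.
  rewrite !(mulmx0, mul0mx, addr0, add0r) ZMZ.
  rewrite -![_ *m M *m P]mulmxA MP !mulmxA ZC mul0mx.
  rewrite -![S *m P' *m C^T]mulmxA PC mulmx1 SS.
  by rewrite -![S *m P' *m M]mulmxA PM mulmxA SS mul1mx CZ row_mx0 col_mx0.
(* The heads are the columns of (0, S'), so the coefficients S mu produce (0, mu). *)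
exists W; have := WX (S *m mu).
by rewrite mul_col_mx mul0mx mulmxA (mulmx1C SS) mul1mx.
Qed.

(** * Hermitian forms and simultaneous diagonalization *)

Local Open Scope sesquilinear_scope.

Definition hermitian_posdef (F : numClosedFieldType) n (M : 'M[F]_n) : Prop :=
  M^t* = M /\ forall u : 'cV[F]_n, u != 0 -> 0 < (u^t* *m M *m u) 0 0.

Lemma trmxC_mul (F : numClosedFieldType) p q r (A : 'M[F]_(p, q))
    (B : 'M[F]_(q, r)) : (A *m B)^t* = B^t* *m A^t*.
Proof. by rewrite trmx_mul map_mxM. Qed.

Lemma hermitian_diagonalization (F : numClosedFieldType) n (H : 'M[F]_n) :
  H^t* = H ->
  exists (U : 'M[F]_n) (D : 'rV[F]_n),
    U *m U^t* = 1%:M /\ U *m H *m U^t* = diag_mx D.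
Proof.
move=> HH; have /hermitian_normalmx /orthomx_spectralP : H \is hermsymmx.
  by apply/is_hermitianmxP; rewrite expr0 scale1r HH.
have Uu := spectral_unitarymx H; move/unitarymxP : (Uu) => UU.
rewrite invmx_unitary // => HE.
exists (spectralmx H), (spectral_diag H); split=> //.
by rewrite [X in _ *m X *m _]HE !mulmxA UU mul1mx -mulmxA UU mulmx1.
Qed.

(** The form at v is that of M at Q v. It serves both the restriction of M to ker C and the Schur
    complement C M^-1 C^T. *)
Lemma hermitian_posdef_gram (F : numClosedFieldType) n r (M : 'M[F]_n)
    (Q : 'M[F]_(n, r)) :
  hermitian_posdef M -> (forall v : 'cV[F]_r, Q *m v = 0 -> v = 0) ->
  hermitian_posdef (Q^t* *m M *m Q).
Proof.
move=> [MH Mpos] Qinj; split; first by rewrite !trmxC_mul MH trmxCK mulmxA.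
move=> u u0; have /Mpos : Q *m u != 0 by apply: contraNneq u0 => /Qinj->.
by rewrite trmxC_mul !mulmxA.
Qed.

Lemma hermitian_posdef_unit (F : numClosedFieldType) n (M : 'M[F]_n) :
  hermitian_posdef M -> M \in unitmx.
Proof.
move=> [_ Mpos]; rewrite -unitmx_tr -row_free_unit; apply: inj_row_free => v.
move=> /(congr1 trmx); rewrite trmx_mul trmxK trmx0 => Mv.
apply/eqP; rewrite -(inj_eq trmx_inj) trmx0; apply/negP => /negP /Mpos.
by rewrite -mulmxA Mv mulmx0 mxE ltxx.
Qed.

(** A unitary diagonalization of [G], rescaled by inverse square roots of its eigenvalues, turns [G]
    into 1; a unitary diagonalization of the transformed [H] then preserves that identity. *)
Lemma simultaneous_diagonalization (F : numClosedFieldType) n (H G : 'M[F]_n) :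
  H^t* = H -> hermitian_posdef G ->
  exists (S : 'M[F]_n) (D : 'rV[F]_n),
    S^t* *m G *m S = 1%:M /\ S^t* *m H *m S = diag_mx D.
Proof.
move=> HH [GH Gpos]; have [U [g [UU UG]]] := hermitian_diagonalization GH.
have gpos i : 0 < g 0 i.
  (* The eigenvalue [g 0 i] is the value of the form of [G] at the i-th column of U^*. *)
  have /Gpos : U^t* *m delta_mx i 0 != 0 :> 'cV[F]_n.
    apply/eqP => /(congr1 (mulmx U)); rewrite mulmxA UU mul1mx mulmx0.
    by move/matrixP/(_ i 0); rewrite !mxE !eqxx => /eqP; rewrite oner_eq0.
  rewrite trmxC_mul trmxCK !mulmxA -[_ *m U *m G]mulmxA.
  rewrite -[_ *m (U *m G) *m _]mulmxA.
  rewrite UG trmx_delta map_delta_mx -rowE -colE !mxE eqxx.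
  by rewrite mulr1n.
pose s := \row_i (sqrtC (g 0 i))^-1.
pose S := U^t* *m diag_mx s.
have sR : (diag_mx s)^t* = diag_mx s.
  rewrite tr_diag_mx map_diag_mx; congr diag_mx; apply/rowP => i; rewrite !mxE.
  by apply: conj_Creal; rewrite rpredV ger0_real // sqrtC_ge0 ltW.
have SG : S^t* *m G *m S = 1%:M.
  rewrite trmxC_mul sR trmxCK !mulmxA -[_ *m U *m G]mulmxA.
  rewrite -[_ *m (U *m G) *m _]mulmxA.
  rewrite UG !mulmx_diag -diag_const_mx; congr diag_mx; apply/rowP => i.
  have g0 := gpos i; rewrite !mxE mulrAC -invfM -expr2 sqrtCK mulVf //.
  by rewrite gt_eqF.
clearbody S.
have HS : (S^t* *m H *m S)^t* = S^t* *m H *m S.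
  by rewrite !trmxC_mul HH ?trmxCK ?mulmxA.
have [V [D [VV VH]]] := hermitian_diagonalization HS.
have congrE (X : 'M[F]_n) : (S *m V^t*)^t* *m X *m (S *m V^t*) =
    V *m (S^t* *m X *m S) *m V^t* by rewrite trmxC_mul trmxCK !mulmxA.
by exists (S *m V^t*), D; rewrite !congrE SG mulmx1 VV VH.
Qed.

(** * Infinite eigenspace and regularity over a closed field *)

Lemma saddle_infinite_eigenspace (F : numClosedFieldType) N m (K M : 'M[F]_N)
    (C : 'M[F]_(m, N)) (mu : 'cV[F]_m) :
  K^t* = K -> hermitian_posdef M -> C^t* = C^T -> row_free C ->
  infinite_generalized_eigenspace (saddle_mx K C) (extended_mass_mx m M)
    (col_mx 0 mu).
Proof.
move=> KH Mpos CH Cfree; have [MH _] := Mpos.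
have Munit := hermitian_posdef_unit Mpos.
(* The rows of [E], transposed, form a basis of ker C, of dimension N - m by full row rank. *)
have [r [E [NE Efree CE]]] : exists r (E : 'M[F]_(r, N)),
    [/\ N = (r + m)%N, row_free E & C *m E^T = 0].
  exists (\rank (kermx C^T)), (row_base (kermx C^T)).
  rewrite row_base_free; split=> //.
    rewrite mxrank_ker mxrank_tr; move: Cfree (rank_leq_col C) => /eqP->.
    by move=> /subnK.
  apply: trmx_inj; rewrite trmx_mul trmxK trmx0; apply/sub_kermxP.
  by rewrite eq_row_base.
have Gpos : hermitian_posdef (E^T^t* *m M *m E^T).
  apply: hermitian_posdef_gram => // v /(congr1 trmx).
  rewrite trmx_mul trmxK trmx0 => /eqP; rewrite mulmx_free_eq0 // => /eqP vE.
  by apply: trmx_inj; rewrite vE trmx0.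
have HH : (E^T^t* *m K *m E^T)^t* = E^T^t* *m K *m E^T.
  by rewrite !trmxC_mul KH trmxCK mulmxA.
have [V [D [VG VH]]] := simultaneous_diagonalization HH Gpos.
pose Z := E^T *m V.
pose Q := invmx M *m C^T.
have MQ : M *m Q = C^T by rewrite mulKVmx.
have QM : Q^t* *m M = C by rewrite -{1}MH -trmxC_mul MQ -CH trmxCK.
have Qinj (v : 'cV[F]_m) : Q *m v = 0 -> v = 0.
  move=> /(congr1 (mulmx M)); rewrite mulmxA MQ mulmx0 => /(congr1 trmx).
  rewrite trmx_mul trmxK trmx0 => /eqP; rewrite mulmx_free_eq0 // => /eqP vE.
  by apply: trmx_inj; rewrite vE trmx0.
have Spos := hermitian_posdef_gram Mpos Qinj; have [SH _] := Spos.
set S := _ *m Q in Spos SH; have Sunit := hermitian_posdef_unit Spos.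
have SE : S = C *m Q by rewrite /S QM.
have SE' : S = Q^t* *m C^T by rewrite /S -mulmxA MQ.
have CZ : C *m Z = 0 by rewrite mulmxA CE mul0mx.
apply: (@saddle_infinite_eigenspace_basis F N m _ K M C (Q *m invmx S)
  (invmx S *m Q^t*) S (invmx S) Z (Z^t*) D) => //.
- by rewrite -CH -trmxC_mul CZ trmx0 raddf0.
- by rewrite trmxC_mul -!mulmxA in VG *.
- by rewrite trmxC_mul -!mulmxA in VH *.
- by rewrite mulmxA -SE mulmxV.
- by rewrite -mulmxA -SE' mulVmx.
- by rewrite mulmxA MQ.
- by rewrite -mulmxA QM.
- by rewrite mulmxV.
Qed.

(* The shift 'i works because u^* K u is real while 'i u^* M u is not, unless
   u = 0. *)
Lemma saddle_pencil_regular (F : numClosedFieldType) N m (K M : 'M[F]_N)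
    (C : 'M[F]_(m, N)) :
  K^t* = K -> hermitian_posdef M -> C^t* = C^T -> row_free C ->
  \det (saddle_mx K C - 'i *: extended_mass_mx m M) != 0.
Proof.
move=> KH [MH Mpos] CH Cfree; rewrite -unitfE -unitmxE -unitmx_tr.
rewrite -row_free_unit; apply: inj_row_free => v /(congr1 trmx).
rewrite trmx_mul trmxK trmx0 => vE; apply: trmx_inj; rewrite trmx0.
move: vE; move: v^T => {}v; rewrite -[v]vsubmxK; move: (usubmx v) (dsubmx v).
move=> u mu; rewrite mulmxBl -scalemxAl => /eqP; rewrite subr_eq0 => /eqP.
move=> E; have /saddle_mx_eigenP[Ku Cu] := E.
have uC : u^t* *m C^T = 0 by rewrite -CH -trmxC_mul Cu trmx0 raddf0.
(* Testing with u^* removes the multiplier, since C u = 0, and leaves u^* K u = 'i u^* M u. *)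
have := congr1 (mulmx (u^t*)) Ku.
rewrite mulmxDr mulmxA [X in _ + X]mulmxA uC mul0mx addr0 -scalemxAr mulmxA.
move=> uKu.
have real_form (H : 'M[F]_N) : H^t* = H -> (u^t* *m H *m u) 0 0 \is Num.real.
  move=> HH; apply/CrealP; rewrite -[in RHS]HH.
  have -> : u^t* *m H^t* *m u = (u^t* *m H *m u)^t*.
    by rewrite !trmxC_mul trmxCK mulmxA.
  by rewrite !mxE.
have := real_form _ KH; rewrite uKu mxE => iR.
have [u0|/Mpos Mu] := eqVneq u 0; last first.
  have : 'i \is @Num.real F.
    rewrite -[X in X \is _](mulfK (lt0r_neq0 Mu)) rpred_div //.
    by rewrite ger0_real // ltW.
  move=> /CrealP /eqP; rewrite conjCi eq_sym -addr_eq0 -mulr2n mulrn_eq0 /=.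
  by rewrite (negPf (neq0Ci _)).
apply/eqP; apply: contraT => v0; rewrite u0 in E v0.
by case: (@finite_eigenvector_primal_neq0 _ _ _ K M C 'i mu Cfree); split.
Qed.

(** * Transfer between real and complex matrices *)

Lemma complexify_trmxC (R : realType) p q (A : 'M[R]_(p, q)) :
  (complexify A)^t* = complexify A^T.
Proof.
apply/matrixP => i j; rewrite !mxE.
by apply: conj_Creal; rewrite complex_real.
Qed.

Lemma complexify_saddle_mx (R : realType) N m (K : 'M[R]_N) (C : 'M[R]_(m, N)) :
  complexify (saddle_mx K C) = saddle_mx (complexify K) (complexify C).
Proof. by rewrite /complexify /saddle_mx map_block_mx map_trmx map_mx0. Qed.

Lemma complexify_extended_mass_mx (R : realType) N m (M : 'M[R]_N) :
  complexify (extended_mass_mx m M) = extended_mass_mx m (complexify M).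
Proof. by rewrite /complexify /extended_mass_mx map_block_mx !map_mx0. Qed.

(** For u = a + 'i b the cross terms cancel by symmetry of [M], leaving a^T M a + b^T M b, where a
    and b are not both zero. *)
Lemma posdef_complexify (R : realType) N (M : 'M[R]_N) :
  posdef_mx M -> hermitian_posdef (complexify M).
Proof.
move=> [MT Mpos]; split; first by rewrite complexify_trmxC MT.
move=> u u0; pose a := map_mx (@complex.Re R) u; pose b := map_mx (@complex.Im R) u.
have uE : u = complexify a + 'i *: complexify b.
  by apply/matrixP => i j; rewrite !mxE /=; case: (u i j) => x y; simpc.
have M_ge0 (v : 'cV[R]_N) : 0 <= (v^T *m M *m v) 0 0.
  have [->|v0] := eqVneq v 0; last exact/ltW/Mpos.
  by rewrite mulmx0 mxE.
have cross : a^T *m M *m b = b^T *m M *m a.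
  transitivity (a^T *m M *m b)^T; last by rewrite !trmx_mul trmxK MT mulmxA.
  by rewrite [a^T *m M *m b]mx11_scalar tr_scalar_mx.
have uC : u^t* = complexify a^T - 'i *: complexify b^T.
  rewrite {1}uE [(_ + _)^T]linearD /= [('i *: _)^T]linearZ /= map_mxD map_mxZ /=.
  by rewrite !complexify_trmxC conjCi scaleNr.
have -> : u^t* *m complexify M *m u =
    complexify (a^T *m M *m a + b^T *m M *m b).
  rewrite uC [X in _ *m X]uE !(mulmxDl, mulmxDr) !mulNmx -!scalemxAl -!scalemxAr.
  rewrite scalerA -expr2 sqrCi scaleN1r opprK /complexify -!map_mxM cross.
  by rewrite map_mxD addrA subrK.
rewrite mxE ltcR mxE.
have [a0|a0] := eqVneq a 0; last by rewrite ltr_wpDr ?M_ge0 ?Mpos.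
rewrite ltr_wpDl ?M_ge0 // Mpos //; apply: contraNneq u0 => b0.
by rewrite uE a0 b0 /complexify map_mx0 scaler0 addr0.
Qed.

(** The determinant is a real polynomial in the shift; being nonzero at the complex point [z] it is
    not the zero polynomial, so some real shift is not a root. *)
Lemma regular_pencil_complexify (R : realType) k (A B : 'M[R]_k) (z : R[i]) :
  \det (complexify A - z *: complexify B) != 0 -> regular_pencil A B.
Proof.
move=> dz; pose p := \det (map_mx polyC A - 'X *: map_mx polyC B).
have p0 : p != 0.
  apply: contraNneq dz => p0.
  have := congr1 (horner_morph (fun a => mulrC z (real_complex R a))) p0.
  rewrite rmorph0 -det_map_mx => <-; apply/eqP; congr (\det _); apply/matrixP => i j.
  by rewrite !mxE rmorphB rmorphM /= !horner_morphC horner_morphX.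
have [x px] : exists x, ~~ root p x.
  (* These are [size p] distinct points, one more than the degree of [p], so not all are roots. *)
  pose s := [seq i%:R : R | i <- iota 0 (size p)].
  have us : uniq s by rewrite map_inj_uniq ?iota_uniq //; exact: mulrIn.
  have : ~~ all (root p) s.
    apply/negP => /(max_poly_roots p0)/(_ us).
    by rewrite size_map size_iota ltnn.
  by move=> /allPn[x _ px]; exists x.
exists x; move: px; rewrite /root -horner_evalE -det_map_mx.
congr (\det _ != 0); apply/matrixP => i j.
by rewrite !mxE /= /horner_eval !hornerE.
Qed.

Theorem theorem6p5 (R : realType) (d n m : nat) (Omega : set (R * R))
    (T : 'I_n -> triangle R) (C : 'M[R]_(m, broken_dim n d)) :
  (1 <= d)%N ->
  polygonal_domain Omega ->
  triangulation T Omega ->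
  row_free C ->
  (C == smoothness_mx d T)%MS ->
  let K := curlcurl_mx d T in
  let M := mass_mx d T in
  let A := saddle_mx K C in
  let B := extended_mass_mx m M in
  let Kc := complexify K in
  let Mc := complexify M in
  let Cc := complexify C in
  let Ac := complexify A in
  let Bc := complexify B in
  [/\ (forall (lambda : R) (u : 'cV[R]_(broken_dim n d)) (mu : 'cV[R]_m),
         finite_eigenvector A B lambda (col_mx u mu) -> u != 0 ->
         conforming_eigenvalue K M C lambda) /\
      (forall (lambda : R[i]) (u : 'cV[R[i]]_(broken_dim n d))
              (mu : 'cV[R[i]]_m),
         finite_eigenvector Ac Bc lambda (col_mx u mu) -> u != 0 ->
         conforming_eigenvalue Kc Mc Cc lambda),
      (forall lambda : R,
         conforming_eigenvalue K M C lambda -> finite_eigenvalue A B lambda) /\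
      (forall lambda : R[i],
         conforming_eigenvalue Kc Mc Cc lambda ->
         finite_eigenvalue Ac Bc lambda) &
      posdef_mx M ->
      [/\ forall x : 'cV[R]_(broken_dim n d + m),
            B *m x = 0 <-> exists mu : 'cV[R]_m, x = col_mx 0 mu,
          regular_pencil A B,
          forall mu : 'cV[R[i]]_m, mu != 0 ->
            infinite_eigenvector Ac Bc (col_mx 0 mu) /\
            forall lambda : R[i],
              ~ finite_eigenvector Ac Bc lambda (col_mx 0 mu) &
          forall mu : 'cV[R[i]]_m,
            infinite_generalized_eigenspace Ac Bc (col_mx 0 mu)]].
Proof.
move=> _ _ _ Cfree _ K M A B Kc Mc Cc Ac Bc.
have AcE : Ac = saddle_mx Kc Cc by exact: complexify_saddle_mx.
have BcE : Bc = extended_mass_mx m Mc by exact: complexify_extended_mass_mx.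
have Ccfree : row_free Cc by rewrite /row_free mxrank_map.
rewrite AcE BcE; split.
- split=> lambda u mu; exact: conforming_eigenvalue_saddle.
- split=> lambda; exact: finite_eigenvalue_conforming.
move=> Mpos; have Mcpos := posdef_complexify Mpos.
have KT : K^T = K.
  apply/matrixP => i j; rewrite !mxE; apply: eq_bigr => t _.
  by congr tri_integral; apply/funext => p; rewrite mulrC.
have Kch : Kc^t* = Kc by rewrite complexify_trmxC KT.
have Cch : Cc^t* = Cc^T by rewrite complexify_trmxC /Cc /complexify map_trmx.
split.
- move=> x; split=> [|[mu ->]]; last first.
    by rewrite mul_block_col !mulmx0 !mul0mx !addr0 col_mx0.
  rewrite -[x]vsubmxK mul_block_col !mul0mx !addr0 => /eqP.
  rewrite col_mx_eq0 => /andP[/eqP Mx _].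
  (* A nonzero primal part u would give u^T M u > 0, against M u = 0. *)
  exists (dsubmx x); congr col_mx; apply: contraTeq isT => /(Mpos.2).
  by rewrite -mulmxA Mx mulmx0 mxE ltxx.
(* The nonreal shift 'i yields a nonzero determinant, from which a real shift follows. *)
- apply: (@regular_pencil_complexify _ _ A B 'i).
  by rewrite -/Ac -/Bc AcE BcE saddle_pencil_regular.
- move=> mu mu0; split; last first.
    by move=> lambda; exact: finite_eigenvector_primal_neq0.
  split; first by rewrite col_mx_eq0 negb_and mu0 orbT.
  by rewrite mul_block_col !mulmx0 !mul0mx !addr0 col_mx0.
- by move=> mu; exact: saddle_infinite_eigenspace.
Qed.
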